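(* Let $q_0\in(0,1)$, $q_1=1-q_0$, and let $(\zeta_n)_{n\ge1}$ be a sequence of independent identically distributed random variables taking the values $0$ and $1$ with probabilities $q_0$ and $q_1$ respectively. If $q_0\ne\frac12$, then the infinite Bernoulli convolution generated by the Guthrie--Nymann series, i.e. the distribution of the random variable $$\zeta=\sum_{k=1}^{\infty}\left(\frac{3\zeta_{2k-1}}{4^k}+\frac{2\zeta_{2k}}{4^k}\right),$$ is purely singular.
   Context: The Guthrie--Nymann series is $\frac34+\frac24+\frac3{4^2}+\frac2{4^2}+\dots+\frac3{4^k}+\frac2{4^k}+\dots$. The infinite Bernoulli convolution generated by a convergent series $\sum v_n$ (with parameter $q_0$) is the distribution of $\sum v_n\zeta_n$. A distribution is purely singular if there is a Borel set of Lebesgue measure zero having probability $1$. *)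

(* Defs.v *)
From HB Require Import structures.
From mathcomp Require Import all_boot all_order all_algebra finmap.
From mathcomp Require Import all_classical all_reals all_analysis.
Import Order.TTheory GRing.Theory Num.Theory.
Import numFieldNormedType.Exports.

Set Implicit Arguments.
Unset Strict Implicit.
Unset Printing Implicit Defensive.

Local Open Scope classical_set_scope.
Local Open Scope ring_scope.

Definition mutually_independent (d : measure_display) (T : measurableType d)
    (R : realType) (P : probability T R) (X : nat -> {RV P >-> R}) : Prop :=
  forall (J : {fset nat}) (A : nat -> set R),
    (forall i, i \in J -> measurable (A i)) ->
    P (\bigcap_(i in [set` J]) (X i @^-1` A i)) =
    (\prod_(i <- J) P (X i @^-1` A i))%E.

Definition identically_distributed (d : measure_display) (T : measurableType d)
    (R : realType) (P : probability T R) (X : nat -> {RV P >-> R}) : Prop :=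
  forall (i j : nat) (A : set R), measurable A ->
    distribution P (X i) A = distribution P (X j) A.

Definition iid_bernoulli (d : measure_display) (T : measurableType d)
    (R : realType) (P : probability T R) (q0 : R)
    (X : nat -> {RV P >-> R}) : Prop :=
  [/\ mutually_independent X,
      identically_distributed X,
      (forall n, P [set w | X n w = 0] = q0%:E) &
      (forall n, P [set w | X n w = 1] = (1 - q0)%:E)].

(* The law of \sum_n v_n X_n depends only on q0 and v, not on the probability
   space or on the sequence X, hence the existential quantifiers.  Convergence
   is almost sure because X n takes its values in {0, 1} almost surely. *)
Definition is_bernoulli_convolution (R : realType) (q0 : R) (v : R^nat)
    (mu : set R -> \bar R) : Prop :=
  cvgn (series v) /\
  exists (d : measure_display) (T : measurableType d) (P : probability T R)
    (X : nat -> {RV P >-> R}) (Y : {RV P >-> R}),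
    [/\ iid_bernoulli q0 X,
        {ae P, forall w, series (fun n => v n * X n w) @ \oo --> Y w} &
        forall A : set R, measurable A -> mu A = distribution P Y A].

(* Terms are numbered from 0: 3/4, 2/4, 3/4^2, 2/4^2, ... *)
Definition guthrie_nymann (R : realType) : R^nat :=
  fun n => (if odd n then 2 else 3) / 4 ^+ (n./2.+1).

Definition purely_singular (R : realType) (mu : set R -> \bar R) : Prop :=
  exists N : set R,
    [/\ measurable N, lebesgue_measure N = 0%E & mu N = 1%E].

(* Main.v *)
(** For strings [s] of [n] bits let [p s] be their probability under the
    Bernoulli([q0]) product law.  The sum of [sqrt (p s * 2^-n)] over all [s] is
    [rho^n] with [rho = (sqrt q0 + sqrt (1 - q0)) / sqrt 2], and [rho < 1] as
    soon as [q0 <> 1/2].  Call [s] heavy when [2^-n <= p s].  There are at most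
    [2^n rho^n] heavy strings, and the first [n] digits form a light string with
    probability at most [rho^n].  Because the tail of the generating series is
    at most [2 * 2^-n], the heavy strings yield intervals of total length at most
    [2 rho^n] which miss the random sum with probability at most [rho^n].  By
    Borel-Cantelli, applied to Lebesgue measure and to the law of the sum, the
    limsup of these unions of intervals is a null set of probability 1. *)

Require Import Defs.
From HB Require Import structures.
From mathcomp Require Import all_boot all_order all_algebra finmap.
From mathcomp Require Import all_classical all_reals all_analysis.
From mathcomp Require Import ring lra zify.
Import Order.TTheory GRing.Theory Num.Theory.
Import numFieldNormedType.Exports.
Local Open Scope classical_set_scope.
Local Open Scope ring_scope.

Set Implicit Arguments.
Unset Strict Implicit.

(** * Borel-Cantelli criterion for pure singularity *)

Lemma nneseries_geometric_lty (R : realType) (a r : R) (u : (\bar R)^nat) :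
  0 <= r < 1 -> (forall n, 0 <= u n)%E ->
  (forall n, u n <= (a * r ^+ n)%:E)%E -> (\sum_(n <oo) u n < +oo)%E.
Proof.
move=> /andP[r0 r1] u0 ule.
apply: (@le_lt_trans _ _ (\sum_(n <oo) (a * r ^+ n)%:E)%E).
  by apply: lee_nneseries => // n _.
have -> : (\sum_(n <oo) (a * r ^+ n)%:E)%E =
    (limn (series (geometric a r)))%:E; last exact: ltry.
rewrite -EFin_lim; last by apply: is_cvg_geometric_series; rewrite ger0_norm.
by congr (limn _); apply/funext => n /=; rewrite /series/= sumEFin.
Qed.

(** Almost every point for [mu] lies in all but finitely many [C n], hence in their limsup, which is
    Lebesgue-null. *)
Lemma purely_singular_geometric_cover (R : realType) (mu : probability R R)
    (C : (set R)^nat) (a r : R) : 0 <= r < 1 ->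
  (forall n, measurable (C n)) ->
  (forall n, lebesgue_measure (C n) <= (a * r ^+ n)%:E)%E ->
  (forall n, mu (~` C n) <= (r ^+ n)%:E)%E ->
  purely_singular mu.
Proof.
move=> r01 mC lC muC.
have mN : measurable (lim_sup_set C).
  by apply: bigcapT_measurable => n; apply: bigcup_measurable.
exists (lim_sup_set C); split => //.
  by apply: lim_sup_set_cvg0 => //; exact: nneseries_geometric_lty r01 _ lC.
suff muN0 : mu (~` lim_sup_set C) = 0%E.
  by rewrite -(setCK (lim_sup_set C)) probability_setC ?muN0 ?sube0//;
    exact: measurableC.
have mC' n : measurable (~` C n) by exact: measurableC.
apply/eqP; rewrite eq_le measure_ge0 andbT.
have <- : mu (lim_sup_set (fun n => ~` C n)) = 0%E.
  apply: lim_sup_set_cvg0 => //; apply: (@nneseries_geometric_lty _ 1 r) => // n.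
  by rewrite mul1r; exact: muC.
apply: le_measure; rewrite ?inE; first exact: measurableC.
  by apply: bigcapT_measurable => n; apply: bigcup_measurable.
(* [~` limsup C = liminf (~` C)] is contained in [limsup (~` C)]. *)
move=> x /= Nx n _; apply: contra_notP Nx => nx m _.
exists (maxn m n); first by rewrite /= leq_maxl.
apply: contrapT => Cx; apply: nx; exists (maxn m n) => //.
by rewrite /= leq_maxr.
Qed.

(** * Finite unions *)

Lemma mem_bigsetU (U : Type) (I : finType) (D : pred I) (A : I -> set U) i x :
  D i -> A i x -> (\big[setU/set0]_(j | D j) A j) x.
Proof. by move=> Di Ax; rewrite (bigD1 i) //; left. Qed.

Lemma measure_bigsetU_le d (T : ringOfSetsType d) (R : realFieldType)
    (mu : {measure set T -> \bar R}) (I : finType) (D : pred I)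
    (A : I -> set T) : (forall i, measurable (A i)) ->
  (mu (\big[setU/set0]_(i | D i) A i) <= \sum_(i | D i) mu (A i))%E.
Proof.
(* Measurability of the partial unions is carried through the induction, since [measureU2] asks for
   it. *)
move=> mA; suff [] : measurable (\big[setU/set0]_(i | D i) A i) /\
  (mu (\big[setU/set0]_(i | D i) A i) <= \sum_(i | D i) mu (A i))%E by [].
apply: (big_rec2 (fun U s => measurable U /\ (mu U <= s)%E)).
  by rewrite measure0.
move=> i s U _ [mU Us]; split; first exact: measurableU.
by apply: le_trans (measureU2 _ _ _) _ => //; rewrite leeD2l.
Qed.

(** * Heavy strings and their cover *)

Section bernoulli_weights.
Context {R : realType}.
Implicit Types (q : R) (v : R^nat).

Definition bern_weight q (b : bool) : R := if b then 1 - q else q.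

Definition sqrt_weight q n (s : {ffun 'I_n -> bool}) : R :=
  \prod_i Num.sqrt (bern_weight q (s i)).

(* Both sides are square roots: the condition is [2^-n <= p s]. *)
Definition heavy q n : pred {ffun 'I_n -> bool} :=
  fun s => Num.sqrt (1 / 2) ^+ n <= sqrt_weight q s.

(* The Hellinger affinity of Bernoulli(q) and the fair coin. *)
Definition affinity q : R := \sum_b Num.sqrt (bern_weight q b) * Num.sqrt (1 / 2).

Lemma affinity_ge0 q : 0 <= affinity q.
Proof. by apply: sumr_ge0 => b _; rewrite mulr_ge0 ?sqrtr_ge0. Qed.

Lemma affinity_lt1 q : 0 <= q <= 1 -> q <> 1 / 2 -> affinity q < 1.
Proof.
move=> /andP[q0 q1] qh; rewrite /affinity big_bool /=.
set a := Num.sqrt (1 - q); set b := Num.sqrt q; set c := Num.sqrt (1 / 2).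
have aE : a ^+ 2 = 1 - q by rewrite sqr_sqrtr // subr_ge0.
have bE : b ^+ 2 = q by rewrite sqr_sqrtr.
have cE : c ^+ 2 = 1 / 2 by rewrite sqr_sqrtr // divr_ge0.
(* Strictness comes from here: [b = c] would give [q = 1 / 2]. *)
have bc : 0 < (b - c) ^+ 2.
  rewrite lt_neqAle sqr_ge0 andbT eq_sym sqrf_eq0 subr_eq0.
  by apply/eqP => bc; apply: qh; rewrite -bE -cE bc.
(* [(a - c)^2 + (b - c)^2 = 2 - 2 * affinity q] *)
have := sqr_ge0 (a - c); rewrite !expr2 in aE bE cE bc *; nra.
Qed.

(** Affinity is multiplicative on product laws: the [n]-th power of a sum over one bit expands into
    a sum over strings. *)
Lemma sum_sqrt_weight q n :
  \sum_(s : {ffun 'I_n -> bool}) sqrt_weight q s * Num.sqrt (1 / 2) ^+ n =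
  affinity q ^+ n.
Proof.
rewrite -[in RHS](card_ord n) -prodr_const /affinity bigA_distr_bigA /=.
apply: eq_bigr => s _; rewrite big_split /=; congr (_ * _).
by rewrite prodr_const card_ord.
Qed.

Lemma sqrt_weight_ge0 q n (s : {ffun 'I_n -> bool}) : 0 <= sqrt_weight q s.
Proof. by apply: prodr_ge0 => i _; exact: sqrtr_ge0. Qed.

(** With [c = sqrt (1 / 2)], one factor of [2^-n = c ^+ n * c ^+ n] is at most [sqrt_weight q s] on
    a heavy [s]. *)
Lemma sum_heavy_le q n :
  \sum_(s : {ffun 'I_n -> bool} | heavy q s) 2^-1 ^+ n <= affinity q ^+ n.
Proof.
rewrite -sum_sqrt_weight; set c := Num.sqrt _.
have cE : c ^+ 2 = 2^-1 by rewrite sqr_sqrtr ?div1r // invr_ge0.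
have t0 (s : {ffun 'I_n -> bool}) : 0 <= sqrt_weight q s * c ^+ n.
  by rewrite mulr_ge0 ?sqrt_weight_ge0 ?exprn_ge0 ?sqrtr_ge0.
rewrite [leRHS](bigID (@heavy q n)) /=.
apply: ler_wpDr; first by apply: sumr_ge0.
apply: ler_sum => s hs; rewrite -cE exprAC expr2.
by rewrite ler_wpM2r ?exprn_ge0 ?sqrtr_ge0.
Qed.

(** Dually, on a light [s] one factor of [p s = sqrt_weight q s ^+ 2] is below [c ^+ n]. *)
Lemma sum_light_le q n : 0 <= q <= 1 ->
  \sum_(s : {ffun 'I_n -> bool} | ~~ heavy q s) \prod_i bern_weight q (s i)
  <= affinity q ^+ n.
Proof.
move=> /andP[q0 q1]; rewrite -sum_sqrt_weight; set c := Num.sqrt _.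
have t0 (s : {ffun 'I_n -> bool}) : 0 <= sqrt_weight q s * c ^+ n.
  by rewrite mulr_ge0 ?sqrt_weight_ge0 ?exprn_ge0 ?sqrtr_ge0.
rewrite [leRHS](bigID (@heavy q n)) /=.
apply: ler_wpDl; first by apply: sumr_ge0.
apply: ler_sum => s; rewrite /heavy -ltNge => /ltW hs.
have -> : \prod_i bern_weight q (s i) = sqrt_weight q s * sqrt_weight q s.
  rewrite -big_split; apply: eq_bigr => i _ /=.
  by rewrite -expr2 sqr_sqrtr // /bern_weight; case: (s i); rewrite ?subr_ge0.
by rewrite ler_wpM2l ?sqrt_weight_ge0.
Qed.

Definition digit_sum v n (s : {ffun 'I_n -> bool}) : R :=
  \sum_(i < n) v i * (s i)%:R.

(** The width is the tail of [2^-i] from index [n] on, so each interval catches all sums with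
    initial digits [s] when [0 <= v i <= 2^-i]. *)
Definition heavy_cover q v n : set R :=
  \big[setU/set0]_(s : {ffun 'I_n -> bool} | heavy q s)
    `[digit_sum v s, digit_sum v s + 2 * 2^-1 ^+ n]%classic.

Lemma measurable_heavy_cover q v n : measurable (heavy_cover q v n).
Proof. by apply: bigsetU_measurable => s _; exact: measurable_itv. Qed.

Lemma lebesgue_heavy_cover q v n :
  (lebesgue_measure (heavy_cover q v n) <= (2 * affinity q ^+ n)%:E)%E.
Proof.
apply: le_trans (measure_bigsetU_le _ _ _) _ => [s|].
  exact: measurable_itv.
have -> : (\sum_(s : {ffun 'I_n -> bool} | heavy q s) lebesgue_measure
      `[digit_sum v s, (digit_sum v s + 2 * 2^-1 ^+ n)%R]%classic)%E =
    (\sum_(s : {ffun 'I_n -> bool} | heavy q s) 2 * 2^-1 ^+ n)%:E.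
  rewrite -sumEFin; apply: eq_bigr => s _.
  rewrite lebesgue_measure_itv /= lte_fin ltrDl mulr_gt0 ?exprn_gt0 ?invr_gt0 //.
  by rewrite -EFinD addrAC subrr add0r.
by rewrite lee_fin -mulr_sumr ler_pM2l // sum_heavy_le.
Qed.

End bernoulli_weights.

(** * Tail estimate and random digits *)

Lemma binary_series_tail (R : realType) (v x : R^nat) (y : R) n :
  (forall i, 0 <= v i <= 2^-1 ^+ i) -> (forall i, 0 <= x i <= 1) ->
  series (fun i => v i * x i) @ \oo --> y ->
  y \in `[series (fun i => v i * x i) n,
          series (fun i => v i * x i) n + 2 * 2^-1 ^+ n].
Proof.
move=> v01 x01 cvy; set u := series _ in cvy *.
have term i : 0 <= v i * x i <= 2^-1 ^+ i.
  have /andP[? vi] := v01 i; have /andP[? xi] := x01 i.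
  rewrite mulr_ge0 //= -[leRHS]mulr1; exact: ler_pM.
have nd : nondecreasing_seq u.
  by apply: nondecreasing_series => i _ _; have /andP[] := term i.
(* The exact geometric partial sum, rather than its bound [2 * 2^-n], lets the induction close. *)
have upper k : u (n + k)%N <= u n + 2 * (2^-1 ^+ n - 2^-1 ^+ (n + k)).
  elim: k => [|k IH]; first by rewrite addn0 subrr mulr0 addr0.
  rewrite addnS /u seriesSr -/u exprS; have /andP[_] := term (n + k)%N; lra.
rewrite in_itv /=; apply/andP; split.
  by apply: (cvgr_to_ge cvy); exists n => // m /= nm; exact: nd.
apply: (cvgr_to_le cvy); exists n => // m /= nm.
rewrite -(subnKC nm); apply: le_trans (upper _) _; rewrite lerD2l ler_pM2l //.
by rewrite gerBl exprn_ge0 // invr_ge0.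
Qed.

Section iid_bernoulli_theory.
Context d (T : measurableType d) (R : realType) (P : probability T R) (q : R).
Context (X : nat -> {RV P >-> R}) (bX : iid_bernoulli q X).

(** The masses [q] and [1 - q] add up to 1 for each digit, and countably many null sets have a null
    union. *)
Lemma iid_bernoulli_ae01 :
  {ae P, forall w, forall i, exists b : bool, X i w = b%:R}.
Proof.
have [_ _ X0 X1] := bX; apply: ae_foralln => i.
have mX (c : R) : measurable [set w | X i w = c].
  exact: (measurable_funPTI (X i) (measurable_set1 c)).
exists (~` ([set w | X i w = 0] `|` [set w | X i w = 1])); split.
- by apply: measurableC; exact: measurableU.
- apply: etrans (probability_setC P (measurableU _ _ (mX 0) (mX 1))) _.
  suff -> : P ([set w | X i w = 0] `|` [set w | X i w = 1]) = 1%E.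
    by rewrite subee.
  transitivity (P [set w | X i w = 0%R] + P [set w | X i w = 1%R])%E.
    apply: measureU => //; rewrite -subset0 => w [] /= ->.
    by move/eqP; rewrite eq_sym oner_eq0.
  by rewrite X0 X1 -EFinD addrC subrK.
- by apply: subsetC => w [] ?; [exists false|exists true].
Qed.

Definition cylinder n (s : {ffun 'I_n -> bool}) : set T :=
  [set w | forall i : 'I_n, X i w = (s i)%:R].

Lemma cylinderE n (s : {ffun 'I_n -> bool}) (b : nat -> bool) :
  (forall i : 'I_n, b i = s i) ->
  cylinder s = \bigcap_(i in [set` [fset i | i in iota 0 n]%fset])
                 (X i @^-1` [set (b i)%:R]).
Proof.
move=> bs; apply/seteqP; split => w /= h.
  move=> i /=; rewrite in_fset mem_iota /= => ltin.
  by have := h (Ordinal ltin); rewrite -bs.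
move=> i; rewrite -bs; apply: h.
by rewrite /= in_fset mem_iota /=.
Qed.

(** Independence is stated for families indexed by [nat], hence the padding by [false] from [n]
    on. *)
Definition extend_bits n (s : {ffun 'I_n -> bool}) (i : nat) : bool :=
  if insub i is Some j then s j else false.

Lemma extend_bitsE n (s : {ffun 'I_n -> bool}) (i : 'I_n) :
  extend_bits s i = s i.
Proof. by rewrite /extend_bits valK. Qed.

Lemma measurable_cylinder n (s : {ffun 'I_n -> bool}) : measurable (cylinder s).
Proof.
rewrite (cylinderE (extend_bitsE s)); apply: bigcap_measurableType => i _.
exact: measurable_funPTI.
Qed.

Lemma probability_cylinder n (s : {ffun 'I_n -> bool}) :
  P (cylinder s) = (\prod_i bern_weight q (s i))%:E.
Proof.
have [indep _ X0 X1] := bX.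
rewrite (cylinderE (extend_bitsE s)) indep; last by move=> i _.
rewrite (perm_big (iota 0 n)) /=; last first.
  by apply: uniq_perm; rewrite ?fset_uniq ?iota_uniq // => i; rewrite in_fset.
rewrite -{1}(subn0 n) big_mkord -prodEFin.
apply: eq_bigr => i _; rewrite extend_bitsE /bern_weight.
by case: (s i); [exact: X1|exact: X0].
Qed.

(** Almost surely, a heavy initial string puts the sum in its interval, so missing the cover forces
    a light cylinder. *)
Lemma bernoulli_convolution_light (v : R^nat) (Y : {RV P >-> R}) n :
  0 <= q <= 1 -> (forall i, 0 <= v i <= 2^-1 ^+ i) ->
  {ae P, forall w, series (fun i => v i * X i w) @ \oo --> Y w} ->
  (P (Y @^-1` (~` heavy_cover q v n)) <= (affinity q ^+ n)%:E)%E.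
Proof.
move=> q01 v01 cvY.
pose L := \big[setU/set0]_(s : {ffun 'I_n -> bool} | ~~ heavy q s) cylinder s.
have mL : measurable L.
  by apply: bigsetU_measurable => s _; exact: measurable_cylinder.
have mY : measurable (Y @^-1` (~` heavy_cover q v n)).
  by apply: measurable_funPTI; apply: measurableC; exact: measurable_heavy_cover.
apply: (@le_trans _ _ (P L)); last first.
  apply: le_trans (measure_bigsetU_le P _ (@measurable_cylinder n)) _.
  rewrite (eq_bigr _ (fun s _ => probability_cylinder s)) sumEFin lee_fin.
  exact: sum_light_le.
have [N [mN PN0 subN]] : {ae P, forall w,
    (forall i, exists b : bool, X i w = b%:R) /\
    series (fun i => v i * X i w) @ \oo --> Y w}.
  by apply: filterI; [exact: iid_bernoulli_ae01|exact: cvY].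
(* The inclusion in [L] is proved off the null set [N], which is therefore adjoined. *)
apply: (@le_trans _ _ (P (L `|` N))); last first.
  by rewrite -[leRHS]adde0 -PN0; exact: measureU2.
apply: le_measure; rewrite ?inE //; first exact: measurableU.
move=> w /= nYw; have [Nw|nNw] := pselect (N w); [by right|left].
have [/choice[b Xb] cvw] : (forall i, exists b : bool, X i w = b%:R) /\
    series (fun i => v i * X i w) @ \oo --> Y w.
  by apply: contrapT => h; apply: nNw; exact: subN.
pose s : {ffun 'I_n -> bool} := [ffun i : 'I_n => b i].
have sumE : digit_sum v s = series (fun i => v i * X i w) n.
  rewrite /series /= big_mkord; apply: eq_bigr => i _.
  by rewrite Xb ffunE.
have [hs|ls] := boolP (heavy q s).
  case: nYw; apply: mem_bigsetU hs _; rewrite /= sumE.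
  apply: binary_series_tail cvw => // i.
  by rewrite Xb; case: (b i); rewrite /= lexx ler01.
apply: (@mem_bigsetU _ _ (fun s => ~~ heavy q s) _ s) => // i.
by rewrite Xb ffunE.
Qed.

End iid_bernoulli_theory.

Lemma bernoulli_convolution_singular d (T : measurableType d) (R : realType)
    (P : probability T R) (q : R) (X : nat -> {RV P >-> R}) (v : R^nat)
    (Y : {RV P >-> R}) :
  0 <= q <= 1 -> q <> 1 / 2 -> iid_bernoulli q X ->
  (forall i, 0 <= v i <= 2^-1 ^+ i) ->
  {ae P, forall w, series (fun i => v i * X i w) @ \oo --> Y w} ->
  purely_singular (distribution P Y).
Proof.
move=> q01 qh bX v01 cvY.
apply: (@purely_singular_geometric_cover _ _ (heavy_cover q v) 2 (affinity q)).
- by rewrite affinity_ge0 affinity_lt1.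
- exact: measurable_heavy_cover.
- exact: lebesgue_heavy_cover.
- by move=> n; exact: (bernoulli_convolution_light bX n q01 v01 cvY).
Qed.

(** * Regrouping a series in pairs *)

Lemma cvgn_half : half @ \oo --> \oo.
Proof.
move=> A [N _ NA]; exists N.*2 => // n /= Nn; apply: NA => /=.
by rewrite -(doubleK N); exact: half_leq.
Qed.

Lemma series_pairs (V : zmodType) (w : nat -> V) n :
  series (fun k => w (2 * k)%N + w (2 * k).+1) n = series w n.*2.
Proof.
elim: n => [|n IH]; first by rewrite /series /= !big_geq.
by rewrite doubleS !seriesSr IH -addrA mul2n.
Qed.

(** Passes from the pairwise sum defining [Z] in the theorem to the termwise sum in
    [is_bernoulli_convolution]. *)
Lemma cvg_series_pairs (R : realType) (w : R^nat) (l : R) :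
  (forall i, 0 <= w i) ->
  series (fun k => w (2 * k)%N + w (2 * k).+1) @ \oo --> l ->
  series w @ \oo --> l.
Proof.
move=> w0; set u := series _ => cvu.
(* Partial sums increase, so [series w n] lies between two consecutive paired sums. *)
have nd : nondecreasing_seq (series w).
  by apply: nondecreasing_series => i _ _.
have cvu1 : (fun n => u n.+1) @ \oo --> l by rewrite cvg_shiftS.
apply: (@squeeze_cvgr _ _ _ _ (u \o half) ((fun n => u n.+1) \o half)).
- by apply: nearW => n; rewrite /u /= !series_pairs !nd //; lia.
- exact: cvg_comp cvgn_half cvu.
- exact: cvg_comp cvgn_half cvu1.
Qed.

(** * The Guthrie-Nymann series *)

Lemma guthrie_nymann_bound (R : realType) i :
  0 <= guthrie_nymann R i <= 2^-1 ^+ i.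
Proof.
(* Once the power of 4 is factored out, the upper bounds read [3/4 <= 1] for even [i] and
   [2/4 <= 1/2] for odd [i]. *)
have -> : (2^-1 : R) ^+ i = 2^-1 ^+ odd i * (4 ^+ i./2)^-1.
  rewrite -[in LHS](odd_double_half i) exprD -mul2n exprM -exprVn.
  by congr (_ * _ ^+ _); rewrite expr2; field.
have : 0 < (4 ^+ i./2 : R)^-1 by rewrite invr_gt0 exprn_gt0.
rewrite /guthrie_nymann exprS invfM.
by case: (odd i); rewrite /= ?expr0 ?expr1; lra.
Qed.

Lemma cvgn_series_guthrie_nymann (R : realType) :
  cvgn (series (@guthrie_nymann R)).
Proof.
apply: (@series_le_cvg _ _ (geometric 1 2^-1)) => [i|i|i|].
- by have /andP[] := guthrie_nymann_bound R i.
- by rewrite /= mul1r exprn_ge0 // invr_ge0.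
- by rewrite /= mul1r; have /andP[] := guthrie_nymann_bound R i.
- by apply: is_cvg_geometric_series; rewrite ger0_norm ?invr_ge0 //; lra.
Qed.

Unset Implicit Arguments.
Set Strict Implicit.

Theorem theorem5 (R : realType) (q0 : R) (hq0 : 0 < q0 < 1)
    (hq0_half : q0 <> 1 / 2)
    (d : measure_display) (T : measurableType d) (P : probability T R)
    (zeta : nat -> {RV P >-> R}) (hzeta : iid_bernoulli q0 zeta)
    (Z : {RV P >-> R})
    (hZ : {ae P, forall w,
       series (fun k : nat => 3 * zeta (2 * k)%N w / 4 ^+ k.+1 +
                              2 * zeta (2 * k).+1 w / 4 ^+ k.+1)
         @ \oo --> Z w}) :
  is_bernoulli_convolution q0 (@guthrie_nymann R) (distribution P Z) /\
  purely_singular (distribution P Z).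
Proof.
have cvZ : {ae P, forall w,
    series (fun n => guthrie_nymann R n * zeta n w) @ \oo --> Z w}.
  (* Regrouping needs nonnegative terms, which the digits provide almost surely. *)
  move: (iid_bernoulli_ae01 hzeta) hZ; apply: filterS2 => w zeta01 cvw.
  apply: cvg_series_pairs => [i|].
    have /andP[v0 _] := guthrie_nymann_bound R i.
    by have [b ->] := zeta01 i; rewrite mulr_ge0.
  suff -> : (fun k => guthrie_nymann R (2 * k)%N * zeta (2 * k)%N w +
                      guthrie_nymann R (2 * k).+1 * zeta (2 * k).+1 w) =
            (fun k => 3 * zeta (2 * k)%N w / 4 ^+ k.+1 +
                      2 * zeta (2 * k).+1 w / 4 ^+ k.+1) by [].
  apply/funext => k.
  rewrite /guthrie_nymann mul2n /= odd_double doubleK uphalf_double /=.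
  by rewrite [3 / _ * _]mulrAC [2 / _ * _]mulrAC.
split; last first.
  apply: (bernoulli_convolution_singular _ hq0_half hzeta _ cvZ).
    by case/andP: hq0 => /ltW -> /ltW ->.
  exact: guthrie_nymann_bound.
split; first exact: cvgn_series_guthrie_nymann.
by exists d, T, P, zeta, Z; split.
Qed.
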